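(* Let $\mathcal{R}$ be a unital commutative ring, $\mathcal{A}$ a unital $\mathcal{R}$-algebra, $\mathcal{B}$ an $\mathcal{R}$-module, $m\in\mathbb{Z}_{\geq1}$ and $d\in[m]$. Let $\Omega$ be an nc set over $Gr^{(d;m)}(\mathcal{A})$, and let $f:\Omega\to M(\mathcal{B})$ be a graded function. Then the following are equivalent: (a) $f$ is nc. (b) For any $n,n'\in\mathbb{Z}_{\geq1}$, $T\in M_{n,n'}(\mathcal{R})$, $\sigma\in\Omega_{n}$ and $\sigma'\in\Omega_{n'}$, $$\begin{bmatrix} I_{n}&T\\ 0&I_{n'}\end{bmatrix}\cdot(\sigma\oplus\sigma')=\sigma\oplus\sigma'\quad\Rightarrow\quad f(\sigma)T=Tf(\sigma').$$
   Context: Notation: $[k]=\{1,\dots,k\}$. Scalars in $\mathcal{R}$ act centrally on $\mathcal{A}$. For an $\mathcal{R}$-module $\mathcal{M}$, $M_{n,n'}(\mathcal{M})=\mathcal{M}\otimes_{\mathcal{R}}M_{n,n'}(\mathcal{R})$ ($n\times n'$ matrices over $\mathcal{M}$), $M_n(\mathcal{M})=M_{n,n}(\mathcal{M})$, $M(\mathcal{M})=\bigsqcup_{n\geq1}M_n(\mathcal{M})$. Matrices over $\mathcal{R}$ multiply matrices over $\mathcal{M}$ on either side in the obvious way. An element $A\in M_m(M_n(\mathcal{A}))$ is an $m\times m$ block matrix $[A_{i,j}]_{i,j=1}^m$ with $A_{i,j}\in M_n(\mathcal{A})$. The nc Grassmannian: let $H^{(d;m)}_n(\mathcal{A})$ be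 the set of block matrices $\begin{bmatrix} X & 0 \\ Y & Z \end{bmatrix}$ with $X\in GL_{m-d}(M_n(\mathcal{A}))$, $Y\in M_{d,m-d}(M_n(\mathcal{A}))$, $Z\in GL_d(M_n(\mathcal{A}))$. For $A,B\in GL_m(M_n(\mathcal{A}))$ write $A\sim^{(d;m)}_nB$ iff $A=B\Gamma$ for some $\Gamma\in H^{(d;m)}_n(\mathcal{A})$. Put $Gr^{(d;m)}_n(\mathcal{A})=GL_m(M_n(\mathcal{A}))/\sim^{(d;m)}_n$ and $Gr^{(d;m)}(\mathcal{A})=\bigsqcup_{n\geq1}Gr^{(d;m)}_n(\mathcal{A})$. Operations (all well defined): for $A\in M_m(M_n(\mathcal{A}))$, $A'\in M_m(M_{n'}(\mathcal{A}))$, $A\widetilde{\oplus}A'\in M_m(M_{n+n'}(\mathcal{A}))$ is the block matrix whose $(i,j)$ block is $A_{i,j}\oplus A'_{i,j}$ (block diagonal sum). For $\sigma\in Gr^{(d;m)}_n(\mathcal{A})$, $\sigma'\in Gr^{(d;m)}_{n'}(\mathcal{A})$, the direct sum $\sigma\oplus\sigma'\in Gr^{(d;m)}_{n+n'}(\mathcal{A})$ is the class of $A\widetilde{\oplus}A'$ for $A\in\sigma$, $A'\in\sigma'$. For $s\in GL_n(\mathcal{R})$, $s\cdot\sigma$ is the class of $s^{\oplus m}A$ for $A\in\sigma$, where $s^{\oplus m}$ is the block diagonal matrix with $m$ diagonal blocks equal to $s$. An nc set over $Gr^{(d;m)}(\mathcal{A})$ is $\Omega=\bigsqcup_{n\geq1}\Omega_n$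 with $\Omega_n\subset Gr^{(d;m)}_n(\mathcal{A})$ and $\Omega_n\oplus\Omega_{n'}\subset\Omega_{n+n'}$ for all $n,n'\geq1$. A function $f:\Omega\to M(\mathcal{B})$ is graded if $f(\Omega_n)\subset M_n(\mathcal{B})$ for all $n$. A graded function $f$ is nc if (D) $f(\sigma\oplus\sigma')=f(\sigma)\oplus f(\sigma')$ for all $\sigma,\sigma'\in\Omega$, and (S) $f(s\cdot\sigma)=sf(\sigma)s^{-1}$ whenever $\sigma\in\Omega_n$ and $s\in GL_n(\mathcal{R})$ satisfy $s\cdot\sigma\in\Omega_n$. *)

(* Defs.v *)
From HB Require Import structures.
From mathcomp Require Import all_boot all_order all_algebra.
From mathcomp Require Import boolp classical_sets.

Set Implicit Arguments.
Unset Strict Implicit.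
Unset Printing Implicit Defensive.

Import GRing.Theory.
Local Open Scope quotient_scope.
Local Open Scope ring_scope.

(* Two-sided units of an arbitrary, possibly trivial, ring.  MathComp's
   [GRing.unit] is only available on [unitRingType], which is not inferred for
   matrices over a noncommutative ring. *)
Definition invertible (S : pzRingType) (x : S) : bool :=
  `[< exists y : S, x * y = 1 /\ y * x = 1 >].

Definition units (S : pzRingType) : Type := {x : S | invertible x}.

Section Units.
Variable S : pzRingType.
Implicit Types x y : S.

Lemma invertibleI x y : x * y = 1 -> y * x = 1 -> invertible x.
Proof. by move=> xy yx; apply/asboolP; exists y. Qed.

Definition unit_of x y (xy : x * y = 1) (yx : y * x = 1) : units S :=
  exist _ x (invertibleI xy yx).

Lemma units_ex (u : units S) : exists y, val u * y = 1 /\ y * val u = 1.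
Proof. exact/asboolP/(valP u). Qed.

Definition uinv (u : units S) : S := projT1 (cid (units_ex u)).

Lemma mul_uinv (u : units S) : val u * uinv u = 1.
Proof. by rewrite /uinv; case: cid => y []. Qed.

Lemma uinv_mul (u : units S) : uinv u * val u = 1.
Proof. by rewrite /uinv; case: cid => y []. Qed.

Lemma uinvE (u : units S) y : val u * y = 1 -> y = uinv u.
Proof. by move=> uy; rewrite -[y]mul1r -(uinv_mul u) -mulrA uy mulr1. Qed.

Lemma invertibleM x y : invertible x -> invertible y -> invertible (x * y).
Proof.
move=> /asboolP[x' [xx' x'x]] /asboolP[y' [yy' y'y]].
apply: (@invertibleI _ (y' * x')).
  by rewrite -mulrA (mulrA y) yy' mul1r.
by rewrite -mulrA (mulrA x') x'x mul1r.
Qed.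

Definition umul (u v : units S) : units S :=
  exist _ (val u * val v) (invertibleM (valP u) (valP v)).

End Units.

Notation GL m S := (units 'M[S]_m).

Section Tdsum.
Variables (A : pzRingType) (n n' : nat).

(* The blockwise direct sum, for rectangular block matrices. *)
Definition tdsum p q (M : 'M['M[A]_n]_(p, q)) (M' : 'M['M[A]_n']_(p, q)) :
    'M['M[A]_(n + n')]_(p, q) :=
  \matrix_(i, j) block_mx (M i j) 0 0 (M' i j).

Lemma tdsum0 p q : @tdsum p q 0 0 = 0.
Proof. by apply/matrixP=> i j; rewrite !mxE block_mx0. Qed.

Lemma tdsum1 p : @tdsum p p 1 1 = 1.
Proof.
apply/matrixP=> i j; rewrite !mxE; case: (i == j); rewrite /= ?mulr1n ?mulr0n.
  exact: (esym (scalar_mx_block _ _ _)).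
exact: block_mx0.
Qed.

Lemma tdsumM p q r (M : 'M_(p, q)) (N : 'M_(q, r)) (M' : 'M_(p, q))
    (N' : 'M_(q, r)) :
  tdsum M M' *m tdsum N N' = tdsum (M *m N) (M' *m N').
Proof.
apply/matrixP=> i j; rewrite !mxE; elim/big_rec3: _ => [|k x y z _ ->].
  by rewrite block_mx0.
rewrite !mxE [X in X + _]mulmx_block add_block_mx.
by rewrite !mulmx0 !mul0mx !addr0 !add0r.
Qed.

Lemma tdsum_block p1 p2 q1 q2 (X : 'M_(p1, q1)) (Y : 'M_(p2, q1))
    (Z : 'M_(p2, q2)) (X' : 'M_(p1, q1)) (Y' : 'M_(p2, q1))
    (Z' : 'M_(p2, q2)) :
  tdsum (block_mx X 0 Y Z) (block_mx X' 0 Y' Z')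
    = block_mx (tdsum X X') 0 (tdsum Y Y') (tdsum Z Z').
Proof.
apply/matrixP=> i j; rewrite mxE.
case: (split_ordP i) => i' ->; case: (split_ordP j) => j' ->;
  rewrite ?block_mxEul ?block_mxEur ?block_mxEdl ?block_mxEdr ?mxE //.
exact: block_mx0.
Qed.

Lemma tdsum_cast p q (e : p = q) (M : 'M_p) (M' : 'M_p) :
  tdsum (castmx (e, e) M) (castmx (e, e) M') = castmx (e, e) (tdsum M M').
Proof. by case: q / e; rewrite !castmx_id. Qed.

End Tdsum.

Lemma invertible_tdsum (A : pzRingType) n n' m
    (u : GL m 'M[A]_n) (u' : GL m 'M[A]_n') :
  invertible (tdsum (val u) (val u')).
Proof.
apply: (@invertibleI _ _ (tdsum (uinv u) (uinv u'))).
  by rewrite -[LHS]/(_ *m _) tdsumM [_ *m _]mul_uinv [X in tdsum _ X]mul_uinv tdsum1.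
by rewrite -[LHS]/(_ *m _) tdsumM [_ *m _]uinv_mul [X in tdsum _ X]uinv_mul tdsum1.
Qed.

Definition gl_tdsum (A : pzRingType) n n' m
    (u : GL m 'M[A]_n) (u' : GL m 'M[A]_n') : GL m 'M[A]_(n + n') :=
  exist _ (tdsum (val u) (val u')) (invertible_tdsum u u').

Section Grassmannian.
Variables (m d : nat) (hd : (0 < d <= m)%N) (A : pzRingType) (n : nat).

Let e : (m - d + d = m)%N := subnK (proj2 (andP hd)).

(* [castmx] only identifies the index type ['I_(m - d + d)] with ['I_m]. *)
Definition in_H (G : 'M['M[A]_n]_m) : Prop :=
  exists (X : GL (m - d) 'M[A]_n) (Y : 'M['M[A]_n]_(d, m - d))
         (Z : GL d 'M[A]_n),
    G = castmx (e, e) (block_mx (val X) 0 Y (val Z)).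

Definition gr_rel (a b : GL m 'M[A]_n) : bool :=
  `[< exists G : 'M['M[A]_n]_m, in_H G /\ val a = val b * G >].

Let castM p q (c : p = q) (M N : 'M['M[A]_n]_p) :
  castmx (c, c) M * castmx (c, c) N = castmx (c, c) (M *m N).
Proof. by case: q / c; rewrite !castmx_id. Qed.

Let cast1 p q (c : p = q) : castmx (c, c) 1%:M = 1 :> 'M['M[A]_n]_q.
Proof. by case: q / c; rewrite !castmx_id. Qed.

Lemma in_H1 : in_H 1.
Proof.
have u1 p : invertible (1 : 'M['M[A]_n]_p).
  by apply: (@invertibleI _ _ 1); rewrite mul1r.
exists (exist _ 1 (u1 _)), 0, (exist _ 1 (u1 _)) => /=.
by rewrite -scalar_mx_block cast1.
Qed.

Lemma in_HM G G' : in_H G -> in_H G' -> in_H (G * G').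
Proof.
move=> [X [Y [Z ->]]] [X' [Y' [Z' ->]]].
exists (umul X X'), (Y *m val X' + val Z *m Y'), (umul Z Z').
by rewrite castM mulmx_block !mulmx0 !mul0mx !addr0 !add0r.
Qed.

Lemma in_HV G : in_H G -> exists2 G', in_H G' & G * G' = 1 /\ G' * G = 1.
Proof.
move=> [X [Y [Z ->]]].
exists (castmx (e, e)
  (block_mx (uinv X) 0 (- (uinv Z *m Y *m uinv X)) (uinv Z))).
  exists (unit_of (uinv_mul X) (mul_uinv X)), (- (uinv Z *m Y *m uinv X)).
  by exists (unit_of (uinv_mul Z) (mul_uinv Z)).
have [XV VX] : val X *m uinv X = 1%:M /\ uinv X *m val X = 1%:M.
  by split; [apply: mul_uinv | apply: uinv_mul].
have [ZV VZ] : val Z *m uinv Z = 1%:M /\ uinv Z *m val Z = 1%:M.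
  by split; [apply: mul_uinv | apply: uinv_mul].
rewrite !castM !mulmx_block !mulmx0 !mul0mx !addr0 !add0r XV VX ZV VZ.
rewrite mulmxN mulNmx !mulmxA ZV mul1mx subrr -!mulmxA VX mulmx1 addNr.
by rewrite -scalar_mx_block cast1.
Qed.

Lemma gr_rel_equiv : equiv_class_of gr_rel.
Proof.
split.
- by move=> a; apply/asboolP; exists 1; rewrite mulr1; split=> //; apply: in_H1.
- suff sym a b : gr_rel a b -> gr_rel b a by move=> a b; apply/idP/idP; apply: sym.
  move=> /asboolP[G [/in_HV[G' HG' [GG' _]] ab]]; apply/asboolP.
  by exists G'; rewrite ab -mulrA GG' mulr1.
- move=> b a c /asboolP[G [HG ab]] /asboolP[G' [HG' bc]]; apply/asboolP.
  by exists (G' * G); rewrite mulrA -bc ab; split=> //; apply: in_HM.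
Qed.

Canonical gr_equiv := EquivRelPack gr_rel_equiv.

Definition Gr : Type := {eq_quot gr_equiv}.

Definition gr_class (a : GL m 'M[A]_n) : Gr := \pi_({eq_quot gr_equiv}) a.

Definition gr_repr (x : Gr) : GL m 'M[A]_n := repr (x : {eq_quot gr_equiv}).

Lemma gr_reprK x : gr_class (gr_repr x) = x.
Proof. exact: reprK. Qed.

Lemma gr_classP (a b : GL m 'M[A]_n) :
  gr_class a = gr_class b <->
  exists G : 'M['M[A]_n]_m, in_H G /\ val a = val b * G.
Proof.
by split=> [/eqmodP/asboolP|ab]; [|apply/eqmodP/asboolP].
Qed.

End Grassmannian.

Section DirectSum.
Variables (m d : nat) (hd : (0 < d <= m)%N) (A : pzRingType) (n n' : nat).

Definition gr_dsum (x : Gr hd A n) (x' : Gr hd A n') : Gr hd A (n + n') :=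
  gr_class hd (gl_tdsum (gr_repr x) (gr_repr x')).

Lemma in_H_tdsum (G : 'M['M[A]_n]_m) (G' : 'M['M[A]_n']_m) :
  in_H hd G -> in_H hd G' -> in_H hd (tdsum G G').
Proof.
move=> [X [Y [Z ->]]] [X' [Y' [Z' ->]]]; rewrite tdsum_cast tdsum_block.
by exists (gl_tdsum X X'), (tdsum Y Y'), (gl_tdsum Z Z').
Qed.

Lemma gr_dsum_class (a : GL m 'M[A]_n) (a' : GL m 'M[A]_n') :
  gr_dsum (gr_class hd a) (gr_class hd a') = gr_class hd (gl_tdsum a a').
Proof.
have /gr_classP[G [HG aG]] := gr_reprK (gr_class hd a).
have /gr_classP[G' [HG' aG']] := gr_reprK (gr_class hd a').
apply/gr_classP; exists (tdsum G G'); split; first exact: in_H_tdsum.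
by rewrite [LHS]/= aG aG' -tdsumM.
Qed.

End DirectSum.

Section Action.
Variables (R : comPzRingType) (A : pzRingType) (iota : {rmorphism R -> A}).
Variables (m d : nat) (hd : (0 < d <= m)%N) (n : nat).

(* The block diagonal matrix with [m] diagonal blocks [s]; entries of [s] are
   sent to [A] by the structure morphism of the [R]-algebra [A]. *)
Definition amplify (s : 'M[R]_n) : 'M['M[A]_n]_m := (map_mx iota s)%:M.

Lemma invertible_amplify (s : GL n R) : invertible (amplify (val s)).
Proof.
have mapM (x y : 'M[R]_n) : x * y = 1 -> amplify x * amplify y = 1.
  move=> xy; rewrite -[LHS]/(_ *m _) -scalar_mxM -[X in X%:M]map_mxM.
  by rewrite [_ *m _]xy [map_mx _ _]map_mx1.
by apply: (@invertibleI _ _ (amplify (uinv s))); apply: mapM;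
   rewrite ?mul_uinv ?uinv_mul.
Qed.

Definition gl_amplify (s : GL n R) : GL m 'M[A]_n :=
  exist _ (amplify (val s)) (invertible_amplify s).

Definition gr_act (s : GL n R) (x : Gr hd A n) : Gr hd A n :=
  gr_class hd (umul (gl_amplify s) (gr_repr x)).

Lemma gr_act_class (s : GL n R) (a : GL m 'M[A]_n) :
  gr_act s (gr_class hd a) = gr_class hd (umul (gl_amplify s) a).
Proof.
have /gr_classP[G [HG aG]] := gr_reprK (gr_class hd a).
by apply/gr_classP; exists G; split=> //; rewrite [LHS]/= aG mulrA.
Qed.

End Action.

Section UpperUnitriangular.
Variables (R : comPzRingType) (n n' : nat).

Definition utri_mx (T : 'M[R]_(n, n')) : 'M[R]_(n + n') :=
  block_mx 1%:M T 0 1%:M.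

Let utriK T T' : T + T' = 0 -> utri_mx T * utri_mx T' = 1.
Proof.
move=> TT'; rewrite -[LHS]/(_ *m _) mulmx_block.
rewrite !mulmx1 !mul1mx !mulmx0 !mul0mx !addr0 add0r addrC TT'.
exact: esym (scalar_mx_block _ _ _).
Qed.

Definition utri (T : 'M[R]_(n, n')) : GL (n + n') R :=
  unit_of (utriK (addrN T)) (utriK (addNr T)).

End UpperUnitriangular.

Section ModuleMatrices.
Variables (R : comPzRingType) (B : lmodType R) (p q r : nat).

Definition lmulmx (T : 'M[R]_(p, q)) (b : 'M[B]_(q, r)) : 'M[B]_(p, r) :=
  \matrix_(i, k) \sum_j T i j *: b j k.

Definition rmulmx (b : 'M[B]_(p, q)) (T : 'M[R]_(q, r)) : 'M[B]_(p, r) :=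
  \matrix_(i, k) \sum_j T j k *: b i j.

End ModuleMatrices.

Section NcFunctions.
Variables (R : comPzRingType) (A : pzRingType) (iota : {rmorphism R -> A}).
Variables (B : lmodType R) (m d : nat) (hd : (0 < d <= m)%N).

(* A level-graded subset is a family indexed by all [n : nat]; only the levels
   [n >= 1] are meaningful, and level [0] is never constrained nor used. *)
Definition nc_set (Om : forall n, set (Gr hd A n)) : Prop :=
  forall n n' (x : Gr hd A n) (x' : Gr hd A n'),
    (0 < n)%N -> (0 < n')%N -> Om n x -> Om n' x' ->
    Om (n + n')%N (gr_dsum x x').

(* The value of [f] at level [n] lies in ['M[B]_n]: gradedness is built in. *)
Definition graded_fun (Om : forall n, set (Gr hd A n)) : Type :=
  forall n, Om n -> 'M[B]_n.

(* The element [y] stands for the direct sum as a member of [Om]; it exists,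
   and is unique, when [Om] is an nc set. *)
Definition respects_dsum (Om : forall n, set (Gr hd A n))
    (f : graded_fun Om) : Prop :=
  forall n n' (x : Om n) (x' : Om n') (y : Om (n + n')%N),
    (0 < n)%N -> (0 < n')%N -> val y = gr_dsum (val x) (val x') ->
    f _ y = block_mx (f _ x) 0 0 (f _ x').

Definition respects_sim (Om : forall n, set (Gr hd A n))
    (f : graded_fun Om) : Prop :=
  forall n (x y : Om n) (s : GL n R),
    (0 < n)%N -> val y = gr_act iota s (val x) ->
    f _ y = rmulmx (lmulmx (val s) (f _ x)) (uinv s).

Definition nc_fun (Om : forall n, set (Gr hd A n)) (f : graded_fun Om) : Prop :=
  respects_dsum f /\ respects_sim f.

End NcFunctions.

(* Main.v *)
(* For invertible block matrices [a], [a'] representing sigma, sigma', the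
   unipotent matrix with corner [T] fixes sigma (+) sigma' as soon as
   [T a' = a N] blockwise for some matrix [N] over [R]: moving the unipotent
   matrix across [a (+) a'] turns its corner into [N], and block diagonal
   amplifications belong to [H].  Condition (b) then gives the similarity rule
   from [(T, N) = (s, 1)] applied to [(s . sigma, sigma)], and the direct sum
   rule from the two coordinate inclusions [T = N] of R^n and R^n' into
   R^(n + n').  Conversely, (b) says that the diagonal matrix
   [f (sigma (+) sigma')] commutes with the unipotent matrix. *)
Require Import Defs.
From mathcomp Require Import all_boot all_order all_algebra.
From mathcomp Require Import boolp classical_sets.
Import GRing.Theory.
Local Open Scope ring_scope.

Section ModuleMatrices.
Variables (R : comPzRingType) (B : lmodType R).

Lemma lmul1mx p r (b : 'M[B]_(p, r)) : lmulmx 1%:M b = b.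
Proof.
apply/matrixP=> i k; rewrite mxE (bigD1 i) //= mxE eqxx scale1r big1 ?addr0 //.
by move=> j /negPf ji; rewrite mxE eq_sym ji scale0r.
Qed.

Lemma rmulmx1 p q (b : 'M[B]_(p, q)) : rmulmx b 1%:M = b.
Proof.
apply/matrixP=> i k; rewrite mxE (bigD1 k) //= mxE eqxx scale1r big1 ?addr0 //.
by move=> j /negPf jk; rewrite mxE jk scale0r.
Qed.

Lemma lmul0mx p q r (b : 'M[B]_(q, r)) :
  lmulmx (0 : 'M[R]_(p, q)) b = 0.
Proof. by apply/matrixP=> i k; rewrite !mxE big1 // => j _; rewrite mxE scale0r. Qed.

Lemma rmulmx0 p q r (b : 'M[B]_(p, q)) :
  rmulmx b (0 : 'M[R]_(q, r)) = 0.
Proof. by apply/matrixP=> i k; rewrite !mxE big1 // => j _; rewrite mxE scale0r. Qed.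

Lemma rmul0mx p q r (T : 'M[R]_(q, r)) :
  rmulmx (0 : 'M[B]_(p, q)) T = 0.
Proof. by apply/matrixP=> i k; rewrite !mxE big1 // => j _; rewrite mxE scaler0. Qed.

(** Coefficients act as scalars on the left of [B], so regrouping reverses their order;
    commutativity of [R] restores it. *)
Lemma rmulmxA p q r s (b : 'M[B]_(p, q)) (T : 'M[R]_(q, r)) (T' : 'M[R]_(r, s)) :
  rmulmx (rmulmx b T) T' = rmulmx b (T *m T').
Proof.
apply/matrixP=> i k; rewrite !mxE.
under eq_bigr do rewrite mxE scaler_sumr.
rewrite exchange_big; apply: eq_bigr => j _ /=; rewrite mxE scaler_suml.
by apply: eq_bigr => l _; rewrite scalerA mulrC.
Qed.

Lemma lmul_row_col p q1 q2 r (T1 : 'M[R]_(p, q1)) (T2 : 'M[R]_(p, q2))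
    (b1 : 'M[B]_(q1, r)) (b2 : 'M[B]_(q2, r)) :
  lmulmx (row_mx T1 T2) (col_mx b1 b2) = lmulmx T1 b1 + lmulmx T2 b2.
Proof.
apply/matrixP=> i k; rewrite !mxE big_split_ord.
by congr (_ + _); apply: eq_bigr => j _;
  rewrite ?row_mxEl ?row_mxEr ?col_mxEu ?col_mxEd.
Qed.

Lemma rmul_row_col p q1 q2 r (b1 : 'M[B]_(p, q1)) (b2 : 'M[B]_(p, q2))
    (T1 : 'M[R]_(q1, r)) (T2 : 'M[R]_(q2, r)) :
  rmulmx (row_mx b1 b2) (col_mx T1 T2) = rmulmx b1 T1 + rmulmx b2 T2.
Proof.
apply/matrixP=> i k; rewrite !mxE big_split_ord.
by congr (_ + _); apply: eq_bigr => j _;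
  rewrite ?row_mxEl ?row_mxEr ?col_mxEu ?col_mxEd.
Qed.

Lemma lmul_col_mx p1 p2 q r (T1 : 'M[R]_(p1, q)) (T2 : 'M[R]_(p2, q))
    (b : 'M[B]_(q, r)) :
  lmulmx (col_mx T1 T2) b = col_mx (lmulmx T1 b) (lmulmx T2 b).
Proof.
apply/matrixP=> i k; case: (split_ordP i) => i' ->;
  by rewrite ?col_mxEu ?col_mxEd !mxE; apply: eq_bigr => j _;
     rewrite ?col_mxEu ?col_mxEd.
Qed.

Lemma rmul_col_mx p1 p2 q r (b1 : 'M[B]_(p1, q)) (b2 : 'M[B]_(p2, q))
    (T : 'M[R]_(q, r)) :
  rmulmx (col_mx b1 b2) T = col_mx (rmulmx b1 T) (rmulmx b2 T).
Proof.
apply/matrixP=> i k; case: (split_ordP i) => i' ->;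
  by rewrite ?col_mxEu ?col_mxEd !mxE; apply: eq_bigr => j _;
     rewrite ?col_mxEu ?col_mxEd.
Qed.

Lemma lmul_mx_row p q r1 r2 (T : 'M[R]_(p, q)) (b1 : 'M[B]_(q, r1))
    (b2 : 'M[B]_(q, r2)) :
  lmulmx T (row_mx b1 b2) = row_mx (lmulmx T b1) (lmulmx T b2).
Proof.
apply/matrixP=> i k; case: (split_ordP k) => k' ->;
  by rewrite ?row_mxEl ?row_mxEr !mxE; apply: eq_bigr => j _;
     rewrite ?row_mxEl ?row_mxEr.
Qed.

Lemma rmul_mx_row p q r1 r2 (b : 'M[B]_(p, q)) (T1 : 'M[R]_(q, r1))
    (T2 : 'M[R]_(q, r2)) :
  rmulmx b (row_mx T1 T2) = row_mx (rmulmx b T1) (rmulmx b T2).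
Proof.
apply/matrixP=> i k; case: (split_ordP k) => k' ->;
  by rewrite ?row_mxEl ?row_mxEr !mxE; apply: eq_bigr => j _;
     rewrite ?row_mxEl ?row_mxEr.
Qed.

End ModuleMatrices.

(** Compare the upper right blocks: the first product has [T b'] there, the second has [b T]. *)
Lemma diag_commute_utri (R : comPzRingType) (B : lmodType R) n n'
    (T : 'M[R]_(n, n')) (b : 'M[B]_n) (b' : 'M[B]_n') :
  lmulmx (utri_mx T) (block_mx b 0 0 b') =
    rmulmx (block_mx b 0 0 b') (utri_mx T) ->
  rmulmx b T = lmulmx T b'.
Proof.
rewrite /block_mx /utri_mx /block_mx lmul_col_mx rmul_col_mx => /eq_col_mx[+ _].
rewrite lmul_row_col rmul_row_col rmul0mx addr0 lmul1mx lmul_mx_row rmul_mx_row.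
by rewrite add_row_mx add0r => /eq_row_mx[].
Qed.

Section Grassmannian.
Variables (R : comPzRingType) (A : pzRingType) (iota : {rmorphism R -> A}).

Lemma mulmx_amplifyE n m (M : 'M['M[A]_n]_m) (s : 'M[R]_n) i j :
  (M *m amplify iota m s) i j = M i j *m map_mx iota s.
Proof.
rewrite mxE (bigD1 j) //= mxE eqxx mulr1n big1 ?addr0 // => k /negPf kj.
by rewrite mxE kj mulr0n mulr0.
Qed.

Lemma amplify_mulmxE n m (M : 'M['M[A]_n]_m) (s : 'M[R]_n) i j :
  (amplify iota m s *m M) i j = map_mx iota s *m M i j.
Proof. by rewrite mul_scalar_mx mxE. Qed.

Lemma castmx_amplify n p q (e : p = q) (s : 'M[R]_n) :
  castmx (e, e) (amplify iota p s) = amplify iota q s.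
Proof. by case: q / e; rewrite castmx_id. Qed.

Variables (m d : nat) (hd : (0 < d <= m)%N).

(** An amplification is a scalar block matrix, so splitting [m] as [m - d + d] leaves it block
    diagonal, with smaller amplifications of [s] as its invertible diagonal blocks. *)
Lemma in_H_amplify n (s : GL n R) : in_H hd (amplify iota m (val s)).
Proof.
exists (gl_amplify iota (m - d) s), 0, (gl_amplify iota d s).
by rewrite /= /amplify -scalar_mx_block castmx_amplify.
Qed.

(** This reduces the premise of (b) to an identity between representatives. [N] may differ from [T]
    because the right factor is absorbed into the class. *)
Lemma gr_act_utri_dsum n n' (T N : 'M[R]_(n, n'))
    (a : GL m 'M[A]_n) (a' : GL m 'M[A]_n') :
  (forall i j, map_mx iota T *m val a' i j = val a i j *m map_mx iota N) ->
  gr_act iota (utri T) (gr_dsum (gr_class hd a) (gr_class hd a')) =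
    gr_dsum (gr_class hd a) (gr_class hd a').
Proof.
move=> TaN; rewrite gr_dsum_class gr_act_class; apply/gr_classP.
exists (amplify iota m (val (utri N))); split; first exact: in_H_amplify.
apply/matrixP=> i j; rewrite [LHS]amplify_mulmxE [RHS]mulmx_amplifyE !mxE.
rewrite !map_block_mx !map_mx1 !map_mx0 !mulmx_block TaN.
by rewrite !mulmx1 !mul1mx !mulmx0 !mul0mx !addr0 !add0r.
Qed.

End Grassmannian.

Arguments gr_act_utri_dsum {R A iota m d hd n n' T} N {a a'}.

(* A unital R-algebra, possibly zero: a ring A with a central ring morphism
   iota : R -> A. *)
Theorem proposition3p3 (R : comPzRingType) (A : pzRingType)
    (iota : {rmorphism R -> A})
    (iota_central : forall (r : R) (a : A), GRing.comm (iota r) a)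
    (B : lmodType R) (m d : nat) (hm : (1 <= m)%N) (hd : (0 < d <= m)%N)
    (Om : forall n : nat, set (Gr hd A n)) (hOm : nc_set Om)
    (f : graded_fun B Om) :
  nc_fun iota f <->
  (forall (n n' : nat) (T : 'M[R]_(n, n')) (x : Om n) (x' : Om n'),
     (0 < n)%N -> (0 < n')%N ->
     gr_act iota (utri T) (gr_dsum (val x) (val x')) = gr_dsum (val x) (val x') ->
     rmulmx (f n x) T = lmulmx T (f n' x')).
Proof.
split=> [[fD fS] n n' T x x' n0 n'0 fixT | fT].
  have xx' : Om (n + n')%N (gr_dsum (val x) (val x')).
    by apply: hOm => //; apply: set_valP.
  pose y : Om (n + n')%N := SigSub (mem_set xx').
  have nn'0 : (0 < n + n')%N by rewrite addn_gt0 n0.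
  (* The fixed point [y] is both source and target of the similarity rule, so [f _ y] equals its own
     conjugate by [utri T]. *)
  have := fS _ y y (utri T) nn'0 (esym fixT).
  rewrite (fD _ _ x x' y n0 n'0 erefl) => fyE.
  apply: diag_commute_utri; rewrite [in RHS]fyE rmulmxA.
  by rewrite [X in rmulmx _ X](uinv_mul (utri T)) rmulmx1.
split=> [n n' x x' y n0 n'0 yE | n x y s n0 yE].
  have nn'0 : (0 < n + n')%N by rewrite addn_gt0 n0.
  (* Condition (b) for the pair [(y, x)]: since [gr_dsum] is defined through chosen representatives,
     [val y] is the class of their [gl_tdsum]. *)
  have yl : rmulmx (f _ y) (col_mx 1%:M 0) = lmulmx (col_mx 1%:M 0) (f _ x).
    apply: fT => //; rewrite -(gr_reprK (val x)) yE.
    apply: (gr_act_utri_dsum (col_mx 1%:M 0)) => i j.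
    rewrite mxE map_col_mx map_mx1 map_mx0 mul_col_mx mul_block_col.
    by rewrite !mulmx1 ?mul1mx ?mulmx0 ?mul0mx ?addr0.
  have yr : rmulmx (f _ y) (col_mx 0 1%:M) = lmulmx (col_mx 0 1%:M) (f _ x').
    apply: fT => //; rewrite -(gr_reprK (val x')) yE.
    apply: (gr_act_utri_dsum (col_mx 0 1%:M)) => i j.
    rewrite mxE map_col_mx map_mx1 map_mx0 mul_col_mx mul_block_col.
    by rewrite !mulmx1 !mul1mx !mulmx0 !mul0mx !add0r.
  (* The two inclusions cut out the left and right column halves of [f _ y]. *)
  move: yl yr; rewrite -[f _ y]hsubmxK !rmul_row_col !lmul_col_mx.
  rewrite !rmulmx0 !rmulmx1 !lmul0mx !lmul1mx addr0 add0r => -> ->.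
  by rewrite block_mxEh.
(* If [a'] represents [x], then [y] is represented by [a], the amplified [s] times [a']. *)
have ys : rmulmx (f _ y) (val s) = lmulmx (val s) (f _ x).
  apply: fT => //; rewrite -(gr_reprK (val x)) yE.
  apply: (gr_act_utri_dsum 1%:M) => i j.
  by rewrite map_mx1 mulmx1 [RHS]amplify_mulmxE.
by rewrite -ys rmulmxA [X in rmulmx _ X](mul_uinv s) rmulmx1.
Qed.
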